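(* Let $X$, $Y$ be graphs, let $\varphi:X\to Y$ be a complete orbit homomorphism, and let $C\in\mathcal{C}(X)$. (i) If $y,\overline{y}\in V_{\varphi(C)}$, then $\frac{k_X(y)}{k_C(y)}=\frac{k_X(\overline{y})}{k_C(\overline{y})}$. (ii) $C\cong\varphi(C)$ if and only if there exists $y\in V_{\varphi(C)}$ such that $k_C(y)=1$ and, for every $\overline{y}\in V_{\varphi(C)}$, $k_X(y)=k_X(\overline{y})$. (iii) If there exists $y\in V_{\varphi(C)}$ such that $k_C(y)=k_X(y)$, then for every $\overline{y}\in V_{\varphi(C)}$, $k_C(\overline{y})=k_X(\overline{y})$. (iv) If there exists $y\in V_{\varphi(C)}$ such that $k_C(y)=k_X(y)>1$, then $C\not\cong\varphi(C)$.
   Context: All graphs are finite, undirected, simple and reflexive: a graph $X=(V_X,E_X)$ has a finite nonempty vertex set $V_X$, and $E_X$ consists of all loops $\{x\}$ ($x\in V_X$) together with a (possibly empty) set of $2$-element subsets of $V_X$. A homomorphism $\varphi:X\to Y$ is a map $\varphi:V_X\to V_Y$ such that $\{x_1,x_2\}\in E_X$ implies $\{\varphi(x_1),\varphi(x_2)\}\in E_Y$ (a proper edge may be mapped to a loop). For a subgraph $\hat X$ of $X$, $\varphi(\hat X)=(\varphi(V_{\hat X}),\varphi(E_{\hat X}))$. $\varphi$ is complete if $\varphi(V_X)=V_Y$ and $\varphi(E_X)=E_Y$. $\varphi$ is an orbit homomorphism if there is a subgroup $\mathfrak{G}\leq\mathrm{Aut}(X)$ such that the nonempty fibres of $\varphi$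 are exactly the orbits of $\mathfrak{G}$ on $V_X$. $\cong$ denotes graph isomorphism (existence of a bijective homomorphism mapping edges onto edges). $\mathcal{C}(X)$ is the set of components (maximal connected subgraphs) of $X$; for $y\in V_Y$ and a subgraph $\hat X$ of $X$, $k_{\hat X}(y)=|V_{\hat X}\cap\varphi^{-1}(y)|$ (so $k_X(y)=|\varphi^{-1}(y)|$). *)

(* Defs.v *)
From HB Require Import structures.
From mathcomp Require Import all_boot all_order all_algebra all_fingroup.

Set Implicit Arguments.
Unset Strict Implicit.
Unset Printing Implicit Defensive.

(* Finite nonempty reflexive graphs whose vertices are drawn from an ambient
   finite type T, so that a subgraph of a graph on T is again a graph on T.
   Edges are sets of vertices: all loops [set x], plus some 2-element sets. *)
Record graph (T : finType) := Graph {
  vertices : {set T};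
  edges : {set {set T}};
  vertices_neq0 : vertices != set0;
  edges_wf : [forall e in edges, (e \subset vertices) && (0 < #|e| <= 2)];
  edges_loop : [forall x in vertices, [set x] \in edges] }.

Definition subgraph (T : finType) (X' X : graph T) : Prop :=
  vertices X' \subset vertices X /\ edges X' \subset edges X.

Definition adjacent (T : finType) (X : graph T) : rel T :=
  [rel x y | [set x; y] \in edges X].

Definition connected (T : finType) (X : graph T) : Prop :=
  {in vertices X &, forall x y, connect (adjacent X) x y}.

Definition is_component (T : finType) (C X : graph T) : Prop :=
  [/\ subgraph C X, connected C &
      forall D : graph T,
        subgraph D X -> connected D -> subgraph C D -> subgraph D C].

(* A map V_X -> V_Y is represented by a function between the ambient types;
   its values outside [vertices X] are irrelevant. *)
Definition is_hom (T U : finType) (X : graph T) (Y : graph U) (f : T -> U)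
    : Prop :=
  (forall x, x \in vertices X -> f x \in vertices Y) /\
  (forall x1 x2, [set x1; x2] \in edges X -> [set f x1; f x2] \in edges Y).

Definition edge_image (T U : finType) (f : T -> U) (E : {set {set T}})
    : {set {set U}} := [set f @: e | e : {set T} in E].

Section Image.
Variables (T U : finType) (f : T -> U) (X : graph T).

Lemma image_vertices_neq0 : f @: vertices X != set0.
Proof. by rewrite imset_eq0 vertices_neq0. Qed.

Lemma image_edges_wf :
  [forall e in edge_image f (edges X),
     (e \subset f @: vertices X) && (0 < #|e| <= 2)].
Proof.
apply/forall_inP => _ /imsetP[e eX ->].
have /andP[eV /andP[e0 e2]] := forall_inP (edges_wf X) e eX.
rewrite imsetS //= (leq_trans (leq_imset_card _ _) e2) andbT.
by rewrite card_gt0 imset_eq0 -card_gt0.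
Qed.

Lemma image_edges_loop :
  [forall y in f @: vertices X, [set y] \in edge_image f (edges X)].
Proof.
apply/forall_inP => _ /imsetP[x xX ->]; apply/imsetP; exists [set x].
  exact: (forall_inP (edges_loop X)).
by rewrite imset_set1.
Qed.

Definition image_graph : graph U :=
  Graph image_vertices_neq0 image_edges_wf image_edges_loop.

End Image.

Definition isomorphic (T U : finType) (X : graph T) (Y : graph U) : Prop :=
  exists f : T -> U,
    [/\ is_hom X Y f, {in vertices X &, injective f},
        f @: vertices X = vertices Y & edge_image f (edges X) = edges Y].

Definition complete_hom (T U : finType) (X : graph T) (Y : graph U)
    (f : T -> U) : Prop :=
  [/\ is_hom X Y f, f @: vertices X = vertices Y
    & edge_image f (edges X) = edges Y].

(* As for MathComp's [Aut] of a group, automorphisms are permutations of the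
   ambient type that fix everything outside the vertex set. *)
Definition graph_aut (T : finType) (X : graph T) : {set {perm T}} :=
  [set s : {perm T} | perm_on (vertices X) s
                      & edge_image s (edges X) == edges X].

Definition fibre (T U : finType) (X : graph T) (f : T -> U) (y : U) : {set T} :=
  [set x in vertices X | f x == y].

Definition orbit_hom (T U : finType) (X : graph T) (Y : graph U) (f : T -> U)
    : Prop :=
  is_hom X Y f /\
  exists G : {group {perm T}},
    G \subset graph_aut X /\
    [set fibre X f y | y in vertices Y] :\ set0
      = [set orbit 'P G x | x in vertices X].

Definition fibre_card (T U : finType) (X : graph T) (f : T -> U)
    (X' : graph T) (y : U) : nat :=
  #|vertices X' :&: fibre X f y|.

(* Main.v *)
Require Import Defs.
From HB Require Import structures.
From mathcomp Require Import all_boot all_order all_algebra all_fingroup.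

Set Implicit Arguments.
Unset Strict Implicit.
Unset Printing Implicit Defensive.

(** The group acting with orbits the fibres of [phi] permutes the components of
    [X].  Every vertex of a fibre meeting [C] lies in exactly one translate of
    [C], and each translate meets the fibre in as many points as [C] does.
    Hence [k_X(y) = N * k_C(y)] for all [y] in [phi(C)], where [N] is the number
    of translates of [C]; moreover [C] is isomorphic to [phi(C)] exactly when
    [phi] is injective on [C], that is, when [k_C = 1] on [phi(C)]. *)

Definition connected_class (T : finType) (e : rel T) (x : T) : {set T} :=
  [set z | connect e x z].

Lemma connected_classP (T : finType) (e : rel T) (x z : T) :
  connect_sym e ->
  (connected_class e z == connected_class e x) = connect e x z.
Proof.
move=> sym_e; apply/eqP/idP => [/setP/(_ z) | xz].
  by rewrite !inE connect0.
by apply/setP => w; rewrite !inE (same_connect sym_e xz).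
Qed.

(** Since elements of [G] preserve connectivity, the classes met by the orbit of [a] are exactly the
    translates of the class of [c], and they all cut the orbit in equally many points. *)
Lemma card_orbit_connected_class (T : finType) (e : rel T)
    (G : {group {perm T}}) (c a : T) :
  connect_sym e ->
  {in G, forall s : {perm T}, {mono s : x y / connect e x y}} ->
  connect e c a ->
  #|orbit 'P G a| =
    #|[set connected_class e (s c) | s : {perm T} in G]|
      * #|connected_class e c :&: orbit 'P G a|.
Proof.
move=> sym_e mono_e ca; set P := imset _ _; set O := orbit _ _ _.
(* Sort the orbit by class: [s a] lies in the class of [s c] because [a] lies in that of [c]. *)
rewrite -sum1_card (partition_big (connected_class e) (mem P)) /=; last first.
  move=> _ /orbitP[s sG <-]; apply/imsetP; exists s => //.
  by apply/eqP; rewrite connected_classP // mono_e.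
rewrite -sum_nat_const; apply: eq_bigr => _ /imsetP[s sG ->].
(* The block over the class of [s c] is the image under [s] of the block over the class of [c]. *)
rewrite sum1dep_card -[RHS](card_imset _ (@perm_inj _ s)).
apply: eq_card => x; rewrite inE connected_classP //.
have -> : x = s (s^-1%g x) by rewrite permKV.
rewrite (mem_imset _ _ perm_inj) mono_e // !inE andbC.
by rewrite -[s _]/('P%act _ s) orbit_actr.
Qed.

Section Graphs.
Variables (T : finType) (X : graph T).

Lemma adjacent_sym : connect_sym (adjacent X).
Proof. by apply: sym_connect_sym => x y; rewrite /adjacent /= setUC. Qed.

Lemma edge_subset e : e \in edges X -> e \subset vertices X.
Proof. by move=> eX; have /andP[] := forall_inP (edges_wf X) e eX. Qed.

Lemma connect_vertices x z :
  x \in vertices X -> connect (adjacent X) x z -> z \in vertices X.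
Proof.
move=> xX /connectP[p]; elim: p x xX => [|w p IHp] x xX /=; first by move=> _ ->.
case/andP => xw; apply: IHp.
by apply: (subsetP (edge_subset xw)); rewrite set22.
Qed.

Lemma graph_aut_connect (G : {group {perm T}}) : G \subset graph_aut X ->
  {in G, forall s : {perm T}, {mono s : x y / connect (adjacent X) x y}}.
Proof.
move=> GX.
have homo_s (s : {perm T}) : s \in G ->
    {homo s : x y / connect (adjacent X) x y}.
  move=> sG x y /connectP[p xp ->]; apply/connectP; exists (map s p).
    rewrite path_map; apply: sub_path xp => u v; rewrite /adjacent /= => uv.
    have := subsetP GX _ sG; rewrite inE => /andP[_ /eqP <-].
    by apply/imsetP; exists [set u; v]; rewrite // imsetU1 imset_set1.
  by rewrite last_map.
move=> s sG x y; apply/idP/idP; last exact: homo_s.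
(* Connectivity is reflected because the inverse of [s] is in [G] and preserves it too. *)
by move/(homo_s _ (groupVr sG)); rewrite !permK.
Qed.

Section Induced.
Variable x : T.
Hypothesis xX : x \in vertices X.
Let V := connected_class (adjacent X) x.
Let E := [set e in edges X | e \subset V].

Lemma connected_class_neq0 : V != set0.
Proof. by apply/set0Pn; exists x; rewrite inE connect0. Qed.

Lemma connected_class_edges_wf :
  [forall e in E, (e \subset V) && (0 < #|e| <= 2)].
Proof.
apply/forall_inP => e; rewrite inE => /andP[eX ->] /=.
by have /andP[] := forall_inP (edges_wf X) e eX.
Qed.

Lemma connected_class_edges_loop : [forall z in V, [set z] \in E].
Proof.
apply/forall_inP => z zV; rewrite inE sub1set zV andbT.
apply: (forall_inP (edges_loop X)); apply: connect_vertices xX _.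
by rewrite inE in zV.
Qed.

(** The competitor against which the maximality of a component is tested. *)
Definition induced_class : graph T :=
  Graph connected_class_neq0 connected_class_edges_wf
    connected_class_edges_loop.

Lemma induced_class_subgraph : subgraph induced_class X.
Proof.
split; apply/subsetP => z; rewrite inE; first exact: connect_vertices.
by case/andP.
Qed.

Lemma induced_class_connected : connected induced_class.
Proof.
suff from_x z : z \in V -> connect (adjacent induced_class) x z.
  move=> y z /from_x xy /from_x; apply: connect_trans.
  suff -> : connect_sym (adjacent induced_class) by [].
  by apply: sym_connect_sym => u v; rewrite /adjacent /= setUC.
rewrite inE => /connectP[p xp ->]; apply/connectP; exists p => //.
(* Induction from the end keeps the start [x] fixed, so each new edge has both ends reachable from
   [x] and hence lies in [E]. *)
elim/last_ind: p xp => // p w IHp; rewrite !rcons_path => /andP[xp pw].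
have xl : connect (adjacent X) x (last x p) by apply/connectP; exists p.
rewrite IHp //= [adjacent _ _ _]inE; apply/andP; split; first exact: pw.
rewrite subUset !sub1set !inE xl /=.
exact: connect_trans xl (connect1 pw).
Qed.

End Induced.

(** Connectedness of [C] gives one inclusion; maximality against [induced_class] gives the other. *)
Lemma component_vertices (C : graph T) (x : T) :
  is_component C X -> x \in vertices C ->
  vertices C = connected_class (adjacent X) x.
Proof.
case=> [[CXv CXe] conC maxC] xC; have xX := subsetP CXv x xC.
have CV : vertices C \subset connected_class (adjacent X) x.
  apply/subsetP => z zC; rewrite inE.
  apply: connect_sub (conC x z xC zC) => u v uv.
  by apply: connect1; apply: (subsetP CXe).
apply/eqP; rewrite eqEsubset CV.
have [] // := maxC (induced_class xX).
- exact: induced_class_subgraph.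
- exact: induced_class_connected.
- split=> //; apply/subsetP => e eC; rewrite inE (subsetP CXe) //=.
  apply: subset_trans CV.
  by have /andP[] := forall_inP (edges_wf C) e eC.
Qed.

End Graphs.

(** An isomorphism need not be [phi], but any one forces the vertex set and its image under [phi] to
    have equal finite size, so [phi] is injective there. *)
Lemma isomorphic_image_graphP (T U : finType) (C : graph T) (phi : T -> U) :
  isomorphic C (image_graph phi C) <-> {in vertices C &, injective phi}.
Proof.
split=> [[f [_ injf eqV _]] | inj_phi].
  by apply/imset_injP; rewrite -[phi @: _]eqV card_in_imset.
exists phi; split=> //; split=> [x xC | x1 x2 eC]; first exact: imset_f.
by apply/imsetP; exists [set x1; x2]; rewrite // imsetU1 imset_set1.
Qed.

Section FibreCard.
Variables (T U : finType) (X C : graph T) (phi : T -> U).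
Hypothesis CX : vertices C \subset vertices X.

Lemma fibre_card_gt0 y :
  y \in phi @: vertices C -> 0 < fibre_card X phi C y.
Proof.
case/imsetP => c cC ->; apply/card_gt0P; exists c.
by rewrite !inE cC (subsetP CX) /=.
Qed.

Lemma fibre_card_injP :
  {in vertices C &, injective phi} <->
  {in phi @: vertices C, forall y, fibre_card X phi C y = 1}.
Proof.
split=> [inj_phi y yC | card1 a b aC bC eq_ab].
  apply/eqP; rewrite eqn_leq fibre_card_gt0 // andbT.
  apply/card_le1_eqP => a b; rewrite !inE.
  move=> /and3P[aC _ /eqP ea] /and3P[bC _ /eqP eb].
  by apply: inj_phi; rewrite // ea eb.
have /card_le1_eqP : fibre_card X phi C (phi a) <= 1.
  by rewrite card1 // imset_f.
by apply; rewrite !inE ?aC ?bC ?(subsetP CX) // ?eqxx // eq_ab /=.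
Qed.

End FibreCard.

Lemma fibre_card_component (T U : finType) (X C : graph T) (Y : graph U)
    (phi : T -> U) :
  orbit_hom X Y phi -> is_component C X ->
  exists N, {in phi @: vertices C, forall y,
    fibre_card X phi X y = N * fibre_card X phi C y}.
Proof.
case=> -[homV _] [G [GX orbits]] compC; have [[CX _] _ _] := compC.
have [c cC] := set0Pn _ (vertices_neq0 C).
have eqC := component_vertices compC cC.
(* Counting translates from a fixed base vertex [c] makes [N] independent of [y]. *)
exists #|[set connected_class (adjacent X) (s c) | s : {perm T} in G]|.
move=> _ /imsetP[a aC ->]; have aX := subsetP CX a aC.
have aF : a \in fibre X phi (phi a) by rewrite !inE aX /=.
have : fibre X phi (phi a) \in [set orbit 'P G x | x in vertices X].
  rewrite -orbits !inE imset_f ?homV // andbT.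
  by apply/set0Pn; exists a.
case/imsetP => x _ eqF.
(* The representative [x] may be replaced by [a], which lies in the same orbit. *)
have {}eqF : fibre X phi (phi a) = orbit 'P G a.
  by rewrite eqF in aF *; apply/esym/orbit_eqP.
have -> : fibre_card X phi X (phi a) = #|orbit 'P G a|.
  rewrite -eqF; apply: eq_card => z; rewrite !inE.
  by rewrite andbA andbb.
rewrite /fibre_card eqF eqC; apply: card_orbit_connected_class.
- exact: adjacent_sym.
- exact: graph_aut_connect.
- by rewrite eqC inE in aC.
Qed.

Theorem proposition7p2 (T U : finType) (X : graph T) (Y : graph U)
    (phi : T -> U) (C : graph T)
    (hcomplete : complete_hom X Y phi)
    (horbit : orbit_hom X Y phi)
    (hC : is_component C X) :
  let kX := fibre_card X phi X in
  let kC := fibre_card X phi C in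
  let phiC := image_graph phi C in
  [/\ forall y y' : U, y \in vertices phiC -> y' \in vertices phiC ->
        ((kX y)%:R / (kC y)%:R = (kX y')%:R / (kC y')%:R :> rat)%R,
      isomorphic C phiC <->
        (exists y : U, [/\ y \in vertices phiC, kC y = 1 &
           forall y' : U, y' \in vertices phiC -> kX y = kX y']),
      (exists y : U, y \in vertices phiC /\ kC y = kX y) ->
        forall y' : U, y' \in vertices phiC -> kC y' = kX y'
    & (exists y : U, [/\ y \in vertices phiC, kC y = kX y & 1 < kX y]) ->
        ~ isomorphic C phiC].
Proof.
move=> kX kC phiC.
have [[CX _] _ _] := hC.
have [N kXE] := fibre_card_component horbit hC.
have kC_gt0 y : y \in vertices phiC -> 0 < kC y by apply: fibre_card_gt0.
have kX_gt0 y : y \in vertices phiC -> 0 < kX y.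
  case/imsetP => a aC ->; apply: fibre_card_gt0 => //.
  by rewrite imset_f ?(subsetP CX).
have isoP : isomorphic C phiC <-> {in vertices phiC, forall y, kC y = 1}.
  exact: iff_trans (isomorphic_image_graphP _ _) (fibre_card_injP _ CX).
split.
(* The common ratio is [N]; the division is genuine since [kC y] is positive. *)
- have ratioE y : y \in vertices phiC ->
      ((kX y)%:R / (kC y)%:R = N%:R :> rat)%R.
    move=> yC; rewrite /kX kXE // GRing.natrM GRing.mulfK //.
    by rewrite Num.Theory.pnatr_eq0 -lt0n kC_gt0.
  by move=> y y' yC y'C; rewrite !ratioE.
- split=> [/isoP kC1 | [y [yC kCy kX_const]]].
    have [y yC] := set0Pn _ (vertices_neq0 phiC).
    exists y; split=> //; first exact: kC1.
    by move=> y' y'C; rewrite /kX !kXE // -/kC !kC1.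
  (* Positivity of [N] allows cancelling it in [N * 1 = N * kC y']. *)
  apply/isoP => y' y'C; have N_gt0 : 0 < N.
    by have := kX_gt0 y yC; rewrite /kX kXE // muln_gt0 => /andP[].
  have := kX_const y' y'C; rewrite /kX !kXE // -/kC kCy.
  by move/eqP; rewrite eqn_pmul2l // => /eqP.
- case=> y [yC eq_k] y' y'C.
  (* Equality at the single vertex [y] means that [C] has only one translate. *)
  have N1 : N = 1.
    apply/eqP; rewrite -(eqn_pmul2r (kC_gt0 y yC)) mul1n.
    by rewrite -[N * _]kXE // -/kX -eq_k.
  by rewrite /kX kXE // N1 mul1n.
(* An isomorphism would force [kC y = 1], against [1 < kC y]. *)
- by case=> y [yC <- k_gt1] /isoP kC1; rewrite kC1 in k_gt1.
Qed.
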